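(* Let $X$ be a nondegenerate real random variable with $\mathbb{E}|X|<+\infty$. Let $\nu$ be a Lévy measure with $\int_{-\infty}^{+\infty}|u|\,\nu(du)<+\infty$, let $b\in\mathbb{R}$ and $b_0=b-\int_{-1}^{1}u\,\nu(du)$. Put $b_0^{\pm}=\max(\pm b_0,0)$, $\tilde\nu_+(du)=u\mathbf{1}_{(0,+\infty)}(u)\nu(du)$, $\tilde\nu_-(du)=(-u)\mathbf{1}_{(-\infty,0)}(u)\nu(du)$, and $$m_0^{\pm}=b_0^{\pm}+\int_{\mathbb{R}}\tilde\nu_{\pm}(du),$$ and assume $m_0^+\neq0$ and $m_0^-\neq 0$. Let $Y^+$ and $Y^-$ be random variables such that $X,Y^+,Y^-$ are independent and $Y^{\pm}$ has law $$\mu_{Y^{\pm}}(du)=\frac{b_0^{\pm}}{m_0^{\pm}}\delta_0(du)+\frac{\tilde\nu_{\pm}(du)}{m_0^{\pm}}.$$ Then $$\mathbb{E}Xf(X)=m_0^+\,\mathbb{E}f(X+Y^+)-m_0^-\,\mathbb{E}f(X+Y^-)$$ for all bounded Lipschitz functions $f:\mathbb{R}\to\mathbb{R}$ if and only if $X\sim ID(b,0,\nu)$.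
   Context: A Lévy measure is a positive Borel measure $\nu$ on $\mathbb{R}$ with $\nu(\{0\})=0$ and $\int(1\wedge u^2)\nu(du)<\infty$. $X\sim ID(b,0,\nu)$ means $\mathbb{E}e^{itX}=\exp\big(itb+\int_{-\infty}^{+\infty}(e^{itu}-1-itu\mathbf{1}_{|u|\le1})\nu(du)\big)$ for all $t\in\mathbb{R}$. $\int_{-1}^1$ denotes integration over $\{|u|\le1\}$. *)

(* Defs.v *)
From HB Require Import structures.
From mathcomp Require Import all_boot all_order all_algebra.
From mathcomp Require Import complex.
From mathcomp Require Import all_classical all_reals all_analysis.
From mathcomp Require Import measurable_realfun.
Import Order.TTheory GRing.Theory Num.Theory.
Import numFieldNormedType.Exports.

Set Implicit Arguments.
Unset Strict Implicit.
Unset Printing Implicit Defensive.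

Local Open Scope classical_set_scope.
Local Open Scope ring_scope.

Section complex_integral.
Local Open Scope complex_scope.
Context {R : realType}.

Definition expC (z : R[i]) : R[i] :=
  let: x +i* y := z in (expR x)%:C * (cos y +i* sin y).

(* Componentwise integral. As for [Rintegral], it is meaningful when both
   components are integrable. *)
Definition Cintegral d (T : measurableType d) (mu : {measure set T -> \bar R})
    (f : T -> R[i]) : R[i] :=
  (\int[mu]_x complex.Re (f x)) +i* (\int[mu]_x complex.Im (f x)).

Definition char_fun d (T : measurableType d) (P : probability T R)
    (X : {RV P >-> R}) (t : R) : R[i] :=
  Cintegral P (fun w => expC ('i%C * (t * X w)%:C)).

Definition levy_exponent (b : R)
    (nu : {measure set (measurableTypeR R) -> \bar R}) (t : R) : R[i] :=
  'i%C * (t * b)%:C +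
  Cintegral nu (fun u =>
    expC ('i%C * (t * u)%:C) - 1 -
    'i%C * (t * u * \1_[set v : R | `|v| <= 1] u)%:C).

(* X ~ ID(b, 0, nu): no Gaussian component, truncation function 1_{|u| <= 1}. *)
Definition ID d (T : measurableType d) (P : probability T R)
    (X : {RV P >-> R}) (b : R)
    (nu : {measure set (measurableTypeR R) -> \bar R}) : Prop :=
  forall t : R, char_fun X t = expC (levy_exponent b nu t).

End complex_integral.

Definition levy_measure {R : realType}
    (nu : {measure set (measurableTypeR R) -> \bar R}) : Prop :=
  nu [set 0] = 0%E /\ (\int[nu]_u (Num.min 1 (u ^+ 2))%:E < +oo)%E.

Section random_variables.
Context {R : realType} d (T : measurableType d) (P : probability T R).

Definition nondegenerate_RV (X : {RV P >-> R}) : Prop :=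
  ~ exists c : R, {ae P, forall w, X w = c}.

(* Pairwise independence and independence of subfamilies are the instances in
   which some of the sets are [setT]. *)
Definition independent3 (X Y Z : {RV P >-> R}) : Prop :=
  forall A B C : set (measurableTypeR R),
    measurable A -> measurable B -> measurable C ->
    P (X @^-1` A `&` Y @^-1` B `&` Z @^-1` C) =
    (P (X @^-1` A) * P (Y @^-1` B) * P (Z @^-1` C))%E.

End random_variables.

Section tilted_measures.
Context {R : realType} (nu : {measure set (measurableTypeR R) -> \bar R}).
Local Open Scope ereal_scope.

Definition tnup (A : set (measurableTypeR R)) : \bar R :=
  \int[nu]_(u in A) (u * \1_`]0%R, +oo[ u)%:E.

Definition tnum (A : set (measurableTypeR R)) : \bar R :=
  \int[nu]_(u in A) (- u * \1_`]-oo, 0%R[ u)%:E.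

Let tnup0 : tnup set0 = 0. Proof. exact: integral_set0. Qed.

Let tnup_density_ge0 (u : R) : 0 <= (u * \1_`]0%R, +oo[ u)%:E.
Proof.
rewrite lee_fin indicE.
case: (boolP (_ \in _)) => /= [|_]; last by rewrite mulr0.
by rewrite inE /= in_itv /= andbT mulr1 => /ltW.
Qed.

Let tnup_ge0 A : 0 <= tnup A.
Proof. by apply: integral_ge0 => u _; exact: tnup_density_ge0. Qed.

Let tnup_sigma_additive : semi_sigma_additive tnup.
Proof.
apply: semi_sigma_additive_nng_induced => //.
by apply/measurable_EFinP; apply: measurable_funM => //; exact: measurable_indic.
Qed.

HB.instance Definition _ :=
  isMeasure.Build _ _ _ tnup tnup0 tnup_ge0 tnup_sigma_additive.

Let tnum0 : tnum set0 = 0. Proof. exact: integral_set0. Qed.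

Let tnum_density_ge0 (u : R) : 0 <= (- u * \1_`]-oo, 0%R[ u)%:E.
Proof.
rewrite lee_fin indicE.
case: (boolP (_ \in _)) => /= [|_]; last by rewrite mulr0.
by rewrite inE /= in_itv /= mulr1 oppr_ge0 => /ltW.
Qed.

Let tnum_ge0 A : 0 <= tnum A.
Proof. by apply: integral_ge0 => u _; exact: tnum_density_ge0. Qed.

Let tnum_sigma_additive : semi_sigma_additive tnum.
Proof.
apply: semi_sigma_additive_nng_induced => //.
apply/measurable_EFinP; apply: measurable_funM; last exact: measurable_indic.
exact: oppr_measurable.
Qed.

HB.instance Definition _ :=
  isMeasure.Build _ _ _ tnum tnum0 tnum_ge0 tnum_sigma_additive.

End tilted_measures.

Section masses.
Context {R : realType} (b : R)
  (nu : {measure set (measurableTypeR R) -> \bar R}).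

Definition b0 : R := b - \int[nu]_(u in [set v : R | `|v| <= 1]) u.

Definition b0p : R := Num.max b0 0.

Definition b0m : R := Num.max (- b0) 0.

(* [fine] is harmless when u |-> |u| is nu-integrable: both total masses are
   then finite. *)
Definition m0p : R := b0p + fine (tnup nu setT).

Definition m0m : R := b0m + fine (tnum nu setT).

End masses.

(* X has law (c / m) delta_0 + (1 / m) mu. *)
Definition has_mixture_law {R : realType} d (T : measurableType d)
    (P : probability T R) (X : {RV P >-> R}) (c m : R)
    (mu : {measure set (measurableTypeR R) -> \bar R}) : Prop :=
  forall A : set (measurableTypeR R), measurable A ->
    distribution P X A = ((c / m)%R%:E * \d_(0%R : R) A + (m^-1)%R%:E * mu A)%E.

(* Main.v *)
Require Import Defs.
From HB Require Import structures.
From mathcomp Require Import all_boot all_order all_algebra.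
From mathcomp Require Import all_classical all_reals all_analysis.
From mathcomp Require Import complex measurable_realfun ring lra.
Import Order.TTheory GRing.Theory Num.Theory.
Import numFieldNormedType.Exports.

(**
  Let [L f] be the difference of the two sides of the identity.  Independence
  and the laws of [Y+] and [Y-] give [L (cos (t .)) = S' - (p' S + q' C)] and
  [L (sin (t .)) = - C' + (p' C - q' S)], where [C + i S] is the characteristic
  function of [X] and [p + i q] is the Lévy exponent.  So [L] vanishes on all
  [cos (t .)] and [sin (t .)] iff [(C + i S)' = (p + i q)' (C + i S)], i.e. iff
  [C + i S = exp (p + i q)].

  It remains to pass from trigonometric functions to bounded Lipschitz ones.
  [L] is linear and continuous for bounded pointwise convergence.  The functions
  [(1 - y ^ n) ^ (n * 2 ^ n)] with [y = (1 - sin (t (x - a))) / 2] are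
  trigonometric polynomials, and as [n] tends to infinity and then [t] to 0 they
  converge boundedly to the indicator of the ray [x > a].  Step functions built
  from rays converge to any bounded Lipschitz function.  The same passage from
  rays to Lipschitz functions turns independence and the mixture laws, which are
  statements on sets, into statements on integrals.
*)

Set Implicit Arguments.
Unset Strict Implicit.
Unset Printing Implicit Defensive.

Local Open Scope classical_set_scope.
Local Open Scope ring_scope.

(** * Linear functionals continuous under bounded pointwise convergence *)

Section sigma_linear.
Context {R : realType}.

Definition bounded_measurable (f : R -> R) :=
  measurable_fun setT f /\ exists M, forall x, `|f x| <= M.

(** These are the properties of integration against a finite signed measure that the proof uses.
    Linearity is asked only on bounded measurable functions, because the integral of a
    non-integrable function is a default value. *)
Definition sigma_linear (L : (R -> R) -> R) :=
  (forall a f g, bounded_measurable f -> bounded_measurable g ->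
     L (fun x => a * f x + g x) = a * L f + L g) /\
  (forall (h : nat -> R -> R) f M, (forall n, measurable_fun setT (h n)) ->
     (forall n x, `|h n x| <= M) -> (forall x, h ^~ x @ \oo --> f x) ->
     L (h n) @[n --> \oo] --> L f).

Lemma bounded_measurable_lin a f g : bounded_measurable f ->
  bounded_measurable g -> bounded_measurable (fun x => a * f x + g x).
Proof.
move=> [mf [M fM]] [mg [N gN]]; split.
  by apply: measurable_funD => //; apply: measurable_funM.
exists (`|a| * M + N) => x; rewrite (le_trans (ler_normD _ _))// lerD// normrM.
exact: ler_wpM2l.
Qed.

Lemma bounded_measurable_lim (h : nat -> R -> R) (f : R -> R) M :
  (forall n, measurable_fun setT (h n)) -> (forall n x, `|h n x| <= M) ->
  (forall x, h ^~ x @ \oo --> f x) ->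
  measurable_fun setT f /\ forall x, `|f x| <= M.
Proof.
move=> mh hM hf; split.
  by apply: (measurable_fun_cvg mh) => x _; exact: hf.
move=> x; rewrite -(cvg_lim _ (cvg_norm (hf x)))//; apply: limr_le.
  by apply/cvg_ex; exists `|f x|; exact: cvg_norm.
by near=> n; exact: hM.
Unshelve. all: end_near. Qed.

(** Bounded measurability is carried along with [L f = 0] so that limits can be iterated. *)
Lemma sigma_linear_lim0 L (h : nat -> R -> R) (f : R -> R) M : sigma_linear L ->
  (forall n, bounded_measurable (h n) /\ L (h n) = 0) ->
  (forall n x, `|h n x| <= M) -> (forall x, h ^~ x @ \oo --> f x) ->
  bounded_measurable f /\ L f = 0.
Proof.
move=> [_ Lc] h0 hM hf.
have mh n : measurable_fun setT (h n) by case: (h0 n) => -[].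
split.
  by have [mf fM] := bounded_measurable_lim mh hM hf; split=> //; exists M.
have := Lc h f M mh hM hf; rewrite (_ : (fun n => L (h n)) = fun=> 0).
  by move=> L0; exact: (cvg_unique (@Rhausdorff R) L0 (cvg_cst _)).
by apply/funext => n; case: (h0 n).
Qed.

Lemma sigma_linear_lin a L K : sigma_linear L -> sigma_linear K ->
  sigma_linear (fun f => a * L f + K f).
Proof.
move=> [Ll Lc] [Kl Kc]; split=> [c f g bf bg|h f M mh hM hf].
  by rewrite Ll// Kl//; ring.
by apply: cvgD; [apply: cvgMr; exact: Lc hM hf|exact: Kc hM hf].
Qed.

Lemma sigma_linear0 : sigma_linear (fun=> 0).
Proof. by split=> [*|*]; [rewrite mulr0 addr0|exact: cvg_cst]. Qed.

Lemma sigma_linear_eval (y : R) : sigma_linear (fun f => f y).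
Proof. by split=> // h f M _ _; exact. Qed.

Section integral.
Context d (T : measurableType d) (mu : {measure set T -> \bar R}).
Variables (w Z : T -> R).
Hypothesis iw : mu.-integrable setT (EFin \o w).
Hypothesis mZ : measurable_fun setT Z.

Lemma integrable_mul_bounded (h : T -> R) M : measurable_fun setT h ->
  (forall x, `|h x| <= M) ->
  mu.-integrable setT (EFin \o (fun x => w x * h x)).
Proof.
move=> mh hM.
have mw : measurable_fun setT w by case/integrableP: iw => /measurable_EFinP.
apply: (@le_integrable _ _ _ _ _ measurableT _ (EFin \o (fun x => M * w x))).
- by apply/measurable_EFinP; exact: measurable_funM.
- move=> x _ /=; rewrite lee_fin !normrM mulrC ler_wpM2r//.
  exact: le_trans (hM x) (ler_norm _).
- exact: (integrableZl measurableT M iw).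
Qed.

(** Continuity is dominated convergence with dominating function [|M * w x|]. The weight [w] and the
    inner map [Z] cover the expectations of [X f(X)] and [f(X + Y)] and the integral of [u f(u)]
    against the Lévy measure. *)
Lemma sigma_linear_integral :
  sigma_linear (fun f => \int[mu]_x (w x * f (Z x))).
Proof.
have mw : measurable_fun setT w by case/integrableP: iw => /measurable_EFinP.
have mcomp (f : R -> R) : measurable_fun setT f -> measurable_fun setT (f \o Z).
  by move=> mf; exact: (measurableT_comp mf mZ).
split=> [a f g [mf [M fM]] [mg [N gN]]|h f M mh hM hf].
  have If : mu.-integrable setT (EFin \o (fun x => w x * f (Z x))).
    by apply: (@integrable_mul_bounded _ M) => //; exact: mcomp.
  have Ig : mu.-integrable setT (EFin \o (fun x => w x * g (Z x))).
    by apply: (@integrable_mul_bounded _ N) => //; exact: mcomp.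
  rewrite -RintegralZl// -RintegralD//.
    by apply: eq_Rintegral => x _; ring.
  exact: (integrableZl measurableT a If).
have M0 : 0 <= M by exact: le_trans (normr_ge0 _) (hM 0%N 0).
have [mf fM] := bounded_measurable_lim mh hM hf.
have IM : mu.-integrable setT (EFin \o (fun x => `|M * w x|)).
  exact: (integrable_norm (integrableZl measurableT M iw)).
apply: fine_cvg; rewrite fineK; last first.
  apply: integrable_fin_num => //.
  apply: integrable_mul_bounded (fun x => fM _).
  exact: mcomp.
apply: (@dominated_cvg _ _ _ mu setT measurableT _ _
  (fun x => (`|M * w x|)%:E)) => //.
- by move=> n; apply/measurable_EFinP/measurable_funM => //; exact: mcomp.
- by move=> x _; apply: cvg_EFin; [exact: nearW|apply: cvgMr; exact: hf].
- move=> n x _; rewrite lee_fin !normrM mulrC ler_wpM2r//.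
  exact: le_trans (hM _ _) (ler_norm _).
Qed.
End integral.
End sigma_linear.

(** * From rays to Lipschitz functions by step functions *)

Section rays.
Context {R : realType}.
Implicit Types (f : R -> R) (L : (R -> R) -> R).

(** Interval indicators are written as differences of ray indicators, so that a functional vanishing
    on rays vanishes on [step]. *)
Let step f (a : nat -> R) N : R -> R := fun x =>
  \sum_(k < N)
    f (a k) * (\1_`]a k, +oo[%classic x - \1_`]a k.+1, +oo[%classic x).

Lemma ray_indicE (a x : R) : \1_`]a, +oo[%classic x = (a < x)%R%:R :> R.
Proof. by rewrite indicE mem_setE/= in_itv/= andbT. Qed.

(** Induction on [N]: the last term lives on []a N, a N.+1]], where the previous sum is 0. This is
    why the vanishing outside []a 0, a N]] belongs to the statement. *)
Lemma step_approx f (a : nat -> R) (e : R) N x :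
  (forall k, a k <= a k.+1) ->
  (forall k y, a k < y <= a k.+1 -> `|f (a k) - f y| <= e) ->
  if a 0%N < x <= a N then `|step f a N x - f x| <= e else step f a N x == 0.
Proof.
move=> nda fe; rewrite /step.
have a0 n : a 0%N <= a n by elim: n => // n /le_trans; apply.
elim: N => [|N]; first by rewrite big_ord0 lt_le_asym eqxx.
rewrite big_ord_recr/= !ray_indicE.
have [a0x|xa0]/= := ltP (a 0%N) x; last first.
  by move=> /eqP ->; rewrite !ltNge !(le_trans xa0)//= subrr mulr0 addr0.
have [xN|Nx] := leP x (a N).
  rewrite (le_trans xN (nda N))/= (ltNge (a N.+1)) (le_trans xN (nda N))/=.
  by rewrite subrr mulr0 addr0.
move=> /eqP ->; rewrite add0r.
have [xN|?] := leP x (a N.+1); last by rewrite subrr mulr0.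
by rewrite subr0 mulr1; apply: fe; rewrite Nx xN.
Qed.

Lemma bounded_measurable_ray (b : R) :
  bounded_measurable (\1_`]b, +oo[%classic : R -> R).
Proof.
split; first exact: measurable_indic.
by exists 1 => x; rewrite ray_indicE; case: ltP; rewrite ?normr1 ?normr0.
Qed.

Lemma sigma_linear_step L f a N : sigma_linear L ->
  (forall b : R, L (\1_`]b, +oo[%classic : R -> R) = 0) ->
  bounded_measurable (step f a N) /\ L (step f a N) = 0.
Proof.
move=> [Ll _] L0.
have br := bounded_measurable_ray; have bl := bounded_measurable_lin.
have b0 : bounded_measurable (fun=> 0 : R).
  by split=> //; exists 0 => _; rewrite normr0.
elim: N => [|N [bs Ls]].
  (* The zero function is presented as a combination of rays, so that linearity yields [L 0 = 0]. *)
  rewrite [step _ _ _](_ : _ = fun x => -1 * \1_`]0, +oo[%classic x +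
    \1_`]0, +oo[%classic x); last first.
    by apply/funext=> x; rewrite /step big_ord0; ring.
  by split; [exact: bl|rewrite Ll// !L0 mulr0 addr0].
rewrite [step _ _ _](_ : _ = fun x => f (a N) *
  (-1 * \1_`]a N.+1, +oo[%classic x + \1_`]a N, +oo[%classic x) + step f a N x).
  split; first by do 2 apply: bounded_measurable_lin => //.
  by rewrite Ll ?Ll// ?L0 ?Ls; [ring|exact: bl].
by apply/funext=> x; rewrite /step big_ord_recr/=; ring.
Qed.

Lemma sigma_linear_rays0 L f (C M : R) : sigma_linear L ->
  (forall b : R, L (\1_`]b, +oo[%classic : R -> R) = 0) ->
  (forall x y, `|f x - f y| <= C * `|x - y|) -> (forall x, `|f x| <= M) ->
  L f = 0.
Proof.
move=> sL L0 fC fM.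
have C0 : 0 <= C by have := fC 1 0; rewrite subr0 normr1 mulr1; exact: le_trans.
have M0 : 0 <= M by exact: le_trans (fM 0).
pose e n : R := n.+1%:R^-1.
have e0 n : 0 <= e n by rewrite invr_ge0.
(* A grid of mesh [1 / (n + 1)] starting at [- n]; it reaches [n] after [2 n (n + 1)] cells. On []-
   n, n]] the error is at most [C / (n + 1)], hence at most [C], which gives the uniform bound
   [M + C]. *)
pose a n k : R := k%:R * e n - n%:R.
have aE n : a n (n.*2 * n.+1)%N = n%:R.
  by rewrite /a /e natrM mulfK ?pnatr_eq0// -addnn natrD addrK.
have ak n k y : a n k < y <= a n k.+1 -> `|f (a n k) - f y| <= C * e n.
  move=> /andP[ky yk]; rewrite (le_trans (fC _ _))// ler_wpM2l//.
  rewrite distrC gtr0_norm ?subr_gt0//.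
  by move: yk; rewrite /a -natr1 mulrDl mul1r; lra.
have an n k : a n k <= a n k.+1 by rewrite lerD2r ler_wpM2r// ler_nat.
pose h n := step f (a n) (n.*2 * n.+1)%N.
have hP n x : if - n%:R < x <= n%:R then `|h n x - f x| <= C * e n
    else h n x == 0.
  have := step_approx (n.*2 * n.+1)%N x (an n) (ak n).
  by rewrite aE {1}/a mul0r sub0r.
have hL n := sigma_linear_step f (a n) (n.*2 * n.+1)%N sL L0.
suff [] : bounded_measurable f /\ L f = 0 by [].
apply: (@sigma_linear_lim0 _ L h f (M + C)) => //.
- move=> n x; have := hP n x; case: ifP => [_ hf|_ /eqP ->]; last first.
    by rewrite normr0 addr_ge0.
  rewrite -(subrK (f x) (h n x)) (le_trans (ler_normD _ _))// addrC lerD//.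
  by rewrite (le_trans hf)// ler_piMr// invf_le1 ?ler1n.
- move=> x.
  have : C * e n @[n --> \oo] --> 0.
    by rewrite -[X in _ --> X](mulr0 C); apply: cvgMr; exact: cvg_harmonic.
  move=> /cvgr0Pnorm_le ce; apply/cvgrPdist_le => r r0; near=> n.
  have := hP n x; rewrite ifT => [hf|].
    rewrite distrC (le_trans hf)// (le_trans (ler_norm _))//.
    by near: n; exact: ce.
  have xn : `|x| < n%:R by near: n; exact: nbhs_infty_gtr.
  by move: xn; rewrite ltr_norml => /andP[-> /ltW].
Unshelve. all: end_near. Qed.

End rays.

(** * From trigonometric polynomials to rays *)

Section trigonometric_polynomials.
Context {R : realType}.
Implicit Types (f g : R -> R) (L : (R -> R) -> R).

(** The phase [s] makes sines and constants instances of the single generator. *)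
Inductive trig_poly : (R -> R) -> Prop :=
| trig_poly_cos a t s : trig_poly (fun x => a * cos (t * x + s))
| trig_poly_add f g : trig_poly f -> trig_poly g ->
    trig_poly (fun x => f x + g x).

Lemma trig_poly_cst a : trig_poly (fun=> a).
Proof.
rewrite (_ : (fun=> a) = fun x => a * cos (0 * x + 0)).
  exact: trig_poly_cos.
by apply/funext => x; rewrite mul0r addr0 cos0 mulr1.
Qed.

(** On generators this is the product-to-sum formula for two cosines; sums follow by
    distributivity. *)
Lemma trig_poly_mul f g : trig_poly f -> trig_poly g ->
  trig_poly (fun x => f x * g x).
Proof.
elim=> [a t s|f1 f2 _ IH1 _ IH2] tg; last first.
  rewrite (_ : (fun x => _) = fun x => f1 x * g x + f2 x * g x).
    by apply: trig_poly_add; [exact: IH1|exact: IH2].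
  by apply/funext => x; rewrite mulrDl.
elim: tg => [b t' s'|g1 g2 _ IH1 _ IH2]; last first.
  rewrite (_ : (fun x => _) = fun x =>
    a * cos (t * x + s) * g1 x + a * cos (t * x + s) * g2 x).
    exact: trig_poly_add.
  by apply/funext => x; rewrite mulrDr.
rewrite (_ : (fun x => _) = fun x =>
    a * b / 2 * cos ((t + t') * x + (s + s')) +
    a * b / 2 * cos ((t - t') * x + (s - s'))).
  by apply: trig_poly_add; exact: trig_poly_cos.
apply/funext => x.
have -> : (t + t') * x + (s + s') = (t * x + s) + (t' * x + s') by ring.
have -> : (t - t') * x + (s - s') = (t * x + s) - (t' * x + s') by ring.
by move: (t * x + s) (t' * x + s') => A B; rewrite cosD cosB; field.
Qed.

Lemma trig_poly_exp f n : trig_poly f -> trig_poly (fun x => f x ^+ n).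
Proof.
move=> tf; elim: n => [|n IH].
  rewrite (_ : (fun x => _) = fun=> 1); first exact: trig_poly_cst.
  by apply/funext => x; rewrite expr0.
rewrite (_ : (fun x => _) = fun x => f x * f x ^+ n).
  exact: trig_poly_mul.
by apply/funext => x; rewrite exprS.
Qed.

Lemma bounded_measurable_cos (t s : R) :
  bounded_measurable (fun x => cos (t * x + s)).
Proof.
split; last by exists 1 => x; exact: cos_max.
apply: (@measurableT_comp _ _ _ _ _ _ (@cos R)).
  by apply: continuous_measurable_fun; exact: continuous_cos.
by apply: measurable_funD => //; exact: measurable_funM.
Qed.

Lemma sigma_linear_trig L f : sigma_linear L ->
  (forall t s, L (fun x => cos (t * x + s)) = 0) ->
  trig_poly f -> bounded_measurable f /\ L f = 0.
Proof.
move=> [Ll _] Lcos; have bc := bounded_measurable_cos.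
elim=> [a t s|f1 f2 _ [b1 L1] _ [b2 L2]].
  (* The coefficient [a] is split as [(a - 1) + 1] to match the shape [a * f + g] of
     [sigma_linear]. *)
  rewrite (_ : (fun x => _) = fun x =>
    (a - 1) * cos (t * x + s) + cos (t * x + s)).
    by split; [exact: bounded_measurable_lin|rewrite Ll// Lcos mulr0 addr0].
  by apply/funext => x; ring.
rewrite (_ : (fun x => _) = fun x => 1 * f1 x + f2 x).
  by split; [exact: bounded_measurable_lin|rewrite Ll// L1 L2 mulr0 addr0].
by apply/funext => x; ring.
Qed.

Lemma bernoulli_ineq (x : R) n : -1 <= x -> 1 + n%:R * x <= (1 + x) ^+ n.
Proof.
move=> x1; elim: n => [|n IH]; first by rewrite expr0 mul0r addr0.
rewrite exprS; apply: le_trans (_ : (1 + x) * (1 + n%:R * x) <= _).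
  have -> : (1 + x) * (1 + n%:R * x) = 1 + n.+1%:R * x + n%:R * x ^+ 2.
    by rewrite -natr1; ring.
  by rewrite lerDl mulr_ge0// sqr_ge0.
by apply: ler_wpM2l IH; lra.
Qed.

(** With [s = (1 + r) / 2 < 1] one has [r <= s ^ 2]. Bernoulli applied to [1 / s] bounds [n s ^ n],
    and the second factor [s ^ n] tends to 0. *)
Lemma cvg_natM_expr (r : R) : 0 <= r < 1 -> n%:R * r ^+ n @[n --> \oo] --> 0.
Proof.
move=> /andP[r0 r1].
pose s := (1 + r) / 2; have s0 : 0 < s by rewrite /s; lra.
have s1 : s < 1 by rewrite /s; lra.
have rs : r <= s ^+ 2.
  rewrite /s -subr_ge0 (_ : _ - r = ((1 - r) / 2) ^+ 2) ?sqr_ge0//.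
  by field.
pose e := s^-1 - 1; have e0 : 0 < e by rewrite subr_gt0 invf_gt1.
have ns n : n%:R * s ^+ n <= e^-1.
  rewrite -[leRHS]mul1r ler_pdivlMr// mulrAC -ler_pdivlMr ?exprn_gt0// mul1r.
  rewrite -exprVn (_ : s^-1 = 1 + e); last by rewrite /e; ring.
  apply: le_trans (bernoulli_ineq n _); last by lra.
  by rewrite lerDr.
have : e^-1 * s ^+ n @[n --> \oo] --> 0.
  rewrite -[X in _ --> X](mulr0 e^-1); apply: cvgMr; apply: cvg_expr.
  by rewrite gtr0_norm.
apply: squeeze_cvgr (cvg_cst 0); near=> n; rewrite mulr_ge0 ?exprn_ge0//=.
apply: le_trans (_ : n%:R * s ^+ n * s ^+ n <= _); last first.
  by rewrite ler_wpM2r// exprn_ge0// ltW.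
rewrite -mulrA ler_wpM2l// -exprD addnn -mul2n exprM lerXn2r ?nnegrE ?sqr_ge0//.
Unshelve. all: end_near. Qed.

(* The exponent [n * 2 ^ n], rather than [2 ^ n], forces the limit [0] at
   [y = 1 / 2]. *)
Lemma cvg_threshold (y : R) : 0 <= y <= 1 ->
  (1 - y ^+ n) ^+ (n * 2 ^ n) @[n --> \oo] --> ((y < 1 / 2)%R%:R : R).
Proof.
move=> /andP[y0 y1].
have yn n : 0 <= y ^+ n <= 1 by rewrite exprn_ge0// exprn_ile1.
have yn2 n : (n * 2 ^ n)%:R * y ^+ n = n%:R * (2 * y) ^+ n.
  by rewrite natrM natrX exprMn mulrA.
have [yh|hy] := ltP y (1 / 2).
  (* This is the lower bound that Bernoulli gives for the power; it tends to 1 because [2 y < 1]. *)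
  have h : (1 - n%:R * (2 * y) ^+ n : R) @[n --> \oo] --> (1 : R).
    rewrite -[X in _ --> X]subr0.
    by apply: cvgB; [exact: cvg_cst|apply: cvg_natM_expr; lra].
  apply: (squeeze_cvgr _ h (cvg_cst (1 : R))); near=> n.
  have /andP[? ?] := yn n.
  rewrite exprn_ile1 ?andbT; [|lra|lra].
  rewrite -yn2 -mulrN; apply: bernoulli_ineq; lra.
(* With [N = n * 2 ^ n], the product of [(1 - y ^ n) ^ N] and [(1 + y ^ n) ^ N] is at most 1. By
   Bernoulli the second factor is at least [1 + n (2 y) ^ n >= n + 1], so the first is at most
   [1 / (n + 1)]. *)
apply: (squeeze_cvgr _ (cvg_cst 0) (@cvg_harmonic R)); near=> n.
have /andP[? ?] := yn n.
rewrite exprn_ge0/=; last by lra.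
have h1 : (1 + y ^+ n) ^+ (n * 2 ^ n) >= n.+1%:R.
  apply: le_trans (bernoulli_ineq _ _); last by lra.
  rewrite yn2 -natr1 addrC lerD2l ler_peMr// exprn_ege1//; lra.
rewrite -[leRHS]mul1r ler_pdivlMr//; apply: le_trans (_ : _ <=
  (1 - y ^+ n) ^+ (n * 2 ^ n) * (1 + y ^+ n) ^+ (n * 2 ^ n)) _.
  by apply: ler_wpM2l h1; apply: exprn_ge0; lra.
rewrite -exprMn exprn_ile1//; nra.
Unshelve. all: end_near. Qed.

Lemma sigma_linear_trig_ray L a : sigma_linear L ->
  (forall t s, L (fun x => cos (t * x + s)) = 0) ->
  L (\1_`]a, +oo[%classic : R -> R) = 0.
Proof.
move=> sL Lcos.
(* The phase turns the cosine into [- sin (t (x - a))], so [y t x < 1 / 2] exactly when this sine is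
   positive. *)
pose y t x : R := 1 / 2 + (1 / 2) * cos (t * x + (pi / 2 - t * a)).
have yE t x : y t x = (1 - sin (t * (x - a))) / 2.
  rewrite /y (_ : _ + _ = t * (x - a) + pi / 2); last by ring.
  by rewrite cosDpihalf; field.
have y01 t x : 0 <= y t x <= 1.
  rewrite yE; have := sin_max (t * (x - a)).
  by rewrite ler_norml => /andP[]; lra.
pose h1 t n x := (1 - y t x ^+ n) ^+ (n * 2 ^ n).
have th1 t n : trig_poly (h1 t n).
  apply: trig_poly_exp.
  rewrite (_ : (fun x => _) = fun x => 1 + -1 * y t x ^+ n).
    apply: trig_poly_add (trig_poly_cst _) _.
    apply: trig_poly_mul (trig_poly_cst _) _; apply: trig_poly_exp.
    by apply: trig_poly_add (trig_poly_cst _) _; exact: trig_poly_cos.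
  by apply/funext => x; rewrite mulN1r.
pose h2 (n : nat) x : R := (y n.+1%:R^-1 x < 1 / 2)%R%:R.
have h1_01 t n x : `|h1 t n x| <= 1.
  have /andP[y0 y1] := y01 t x.
  have yn0 : 0 <= y t x ^+ n by exact: exprn_ge0.
  have yn1 : y t x ^+ n <= 1 by exact: exprn_ile1.
  by rewrite ger0_norm ?exprn_ge0 ?exprn_ile1//; lra.
have Lh2 : forall k, bounded_measurable (h2 k) /\ L (h2 k) = 0.
  move=> k.
  apply: (@sigma_linear_lim0 _ L (h1 k.+1%:R^-1) _ 1).
  - by [].
  - by move=> m; exact: sigma_linear_trig.
  - exact: h1_01.
  - by move=> z; exact: cvg_threshold.
suff [] : bounded_measurable (\1_`]a, +oo[%classic : R -> R) /\
  L (\1_`]a, +oo[%classic) = 0 by [].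
apply: (@sigma_linear_lim0 _ L h2 _ 1) => // [n x|x].
  by rewrite /h2; case: ltP; rewrite ?normr1 ?normr0.
apply: cvg_near_cst; near=> m.
rewrite /h2 ray_indicE yE; set z := _ * (x - a).
(* Once [m > |x - a|], the argument [z] lies in []-1, 1[], where [sin z] has the sign of [z]. So
   [h2 m x] is eventually equal to the ray indicator, the endpoint [x = a] included. *)
have z1 : `|z| < 1.
  rewrite normrM gtr0_norm ?invr_gt0// mulrC ltr_pdivrMr// mul1r.
  apply: lt_trans (_ : m%:R < _); last by rewrite ltr_nat.
  by near: m; exact: nbhs_infty_gtr.
move: z1; rewrite ltr_norml => /andP[z1 z1'].
congr ((nat_of_bool _)%:R); have [ax|xa] := ltP a x.
  have /sin2_gt0 : 0 < z < 2 by rewrite mulr_gt0 ?subr_gt0//=; lra.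
  by move=> ?; apply/idP; lra.
have : 0 <= sin (- z).
  apply: sin_ge0_pi; rewrite oppr_ge0 mulr_ge0_le0 ?subr_le0//=.
  by have := pi_ge2 R; lra.
by rewrite sinN => ?; apply/negbTE; rewrite -leNgt; lra.
Unshelve. all: end_near. Qed.

End trigonometric_polynomials.

(** * Mean value inequality and differentiation under the integral sign *)

Section mean_value.
Context {R : realType}.

Lemma mean_value_le (f df : R -> R) (M : R) :
  (forall t : R, is_derive t (1 : R) f (df t)) -> (forall t, `|df t| <= M) ->
  forall s t, `|f s - f t| <= M * `|s - t|.
Proof.
move=> fdf dfM s t; wlog st : s t / t <= s.
  by move=> H; case: (leP t s) => [|/ltW] /H //; rewrite distrC (distrC t).
have cf : {within `[t, s], continuous f}.
  apply: continuous_subspaceT => r.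
  exact/differentiable_continuous/derivable1_diffP.
have [r _ ->] := MVT_segment st (fun x _ => fdf x) cf.
by rewrite normrM ler_wpM2r.
Qed.

Lemma is_derive_sinM (a t : R) :
  is_derive t 1 (fun t => sin (t * a)) (a * cos (t * a)).
Proof. by apply: is_derive_eq; rewrite ?scaler0 /GRing.scale/=; ring. Qed.

Lemma is_derive_cosM (a t : R) :
  is_derive t 1 (fun t => cos (t * a)) (- (a * sin (t * a))).
Proof. by apply: is_derive_eq; rewrite ?scaler0 /GRing.scale/=; ring. Qed.

(** Since [f 0 x = 0], the mean value inequality bounds [|f t x|] by [|t| |X x|]. This makes [f t]
    integrable even when [mu] is infinite, while [|X|] dominates all the derivatives. *)
Lemma is_derive_integral d (T : measurableType d)
    (mu : {measure set T -> \bar R}) (X : T -> R) (f df : R -> T -> R)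
    (t0 : R) :
  mu.-integrable setT (EFin \o X) ->
  (forall t, measurable_fun setT (f t)) -> (forall x, f 0 x = 0) ->
  (forall (t : R) x, is_derive t (1 : R) (f ^~ x) (df t x)) ->
  (forall t x, `|df t x| <= `|X x|) ->
  is_derive t0 1 (fun t => \int[mu]_x f t x) (\int[mu]_x df t0 x).
Proof.
move=> iX mf f0 fdf dfX.
have iaX : mu.-integrable setT (EFin \o (fun x => `|X x|)).
  exact: integrable_norm.
have fX t x : `|f t x| <= `|t| * `|X x|.
  have := mean_value_le (fdf ^~ x) (dfX ^~ x) t 0.
  by rewrite f0 !subr0 mulrC.
have pE t x : partial1of2 f t x = df t x by rewrite partial1of2E derive_val.
have I0 : `]t0 - 1, t0 + 1[%classic t0 by rewrite /= in_itv/=; lra.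
have if_ t : mu.-integrable setT (EFin \o f t).
  apply: (le_integrable measurableT _ _ (integrableZl measurableT `|t| iaX)).
    exact/measurable_EFinP.
  by move=> x _ /=; rewrite lee_fin normrM !normr_id.
have dI : derivable (fun t => \int[mu]_x f t x) t0 1.
  apply: (derivable_under_integral measurableT I0
    (fun t _ => if_ t) _ _ iaX) => //.
  by move=> t x _ _; rewrite pE.
apply: DeriveDef => //.
rewrite -derive1E (differentiation_under_integral measurableT I0
  (fun t _ => if_ t) _ _ iaX) => //.
  by apply: eq_Rintegral => x _; rewrite pE.
by move=> t x _ _; rewrite pE.
Qed.

End mean_value.

(** * The equation [(C + i S)' = (p + i q)' (C + i S)] in real form *)

Section exponential_equation.
Context {R : realType}.
Implicit Types (C S p q dC dS dp dq : R -> R).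

Let der f df := forall t : R, is_derive t (1 : R) (f : R -> R) (df t : R).

Lemma exp_eq_derive C S p q dC dS dp dq : der C dC -> der S dS -> der p dp ->
  der q dq -> (forall t, C t = expR (p t) * cos (q t)) ->
  (forall t, S t = expR (p t) * sin (q t)) ->
  forall t, dC t = dp t * C t - dq t * S t /\ dS t = dp t * S t + dq t * C t.
Proof.
move=> C1 S1 p1 q1 CE SE t.
have pt := p1 t; have qt := q1 t.
have dp_ : is_derive t 1 (fun t => expR (p t)) (dp t * expR (p t)).
  by apply: is_derive_eq; rewrite /GRing.scale/=; ring.
have dc : is_derive t 1 (fun t => cos (q t)) (- (dq t * sin (q t))).
  by apply: is_derive_eq; rewrite /GRing.scale/=; ring.
have ds : is_derive t 1 (fun t => sin (q t)) (dq t * cos (q t)).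
  by apply: is_derive_eq; rewrite /GRing.scale/=; ring.
have -> : dC t = 'D_1 C t by rewrite (@derive_val _ _ _ _ _ _ _ (C1 t)).
have -> : dS t = 'D_1 S t by rewrite (@derive_val _ _ _ _ _ _ _ (S1 t)).
have -> : C = (fun t => expR (p t)) * (fun t => cos (q t)) by exact/funext.
have -> : S = (fun t => expR (p t)) * (fun t => sin (q t)) by exact/funext.
rewrite !derive_val /GRing.scale/= !fctE; split; ring.
Qed.

Lemma exp_eq_unique C S p q dC dS dp dq : der C dC -> der S dS -> der p dp ->
  der q dq -> C 0 = 1 -> S 0 = 0 -> p 0 = 0 -> q 0 = 0 ->
  (forall t, dC t = dp t * C t - dq t * S t /\
             dS t = dp t * S t + dq t * C t) ->
  forall t, C t = expR (p t) * cos (q t) /\ S t = expR (p t) * sin (q t).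
Proof.
move=> C1 S1 p1 q1 C0 S0 p0 q0 dE t.
pose E t := expR (- p t); pose c t := cos (q t); pose s t := sin (q t).
have dp_ (x : R) : is_derive x 1 E (- dp x * E x).
  have pt := p1 x; rewrite /E.
  by apply: is_derive_eq; rewrite /GRing.scale/=; ring.
have dc (x : R) : is_derive x 1 c (- (dq x * s x)).
  have qt := q1 x; rewrite /c /s.
  by apply: is_derive_eq; rewrite /GRing.scale/=; ring.
have ds (x : R) : is_derive x 1 s (dq x * c x).
  have qt := q1 x; rewrite /c /s.
  by apply: is_derive_eq; rewrite /GRing.scale/=; ring.
(* [U] and [V]: the real and imaginary parts of
   [exp (- (p + i q)) * (C + i S)] have derivative 0. *)
have U : E t * (C t * c t + S t * s t) = 1.
  transitivity ((E * (C * c + S * s)) 0).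
    apply: (@is_derive_0_is_cst _ (E * (C * c + S * s))) => x.
    have Cx := C1 x; have Sx := S1 x; have [dCE dSE] := dE x.
    by apply: is_derive_eq; rewrite /GRing.scale/= !fctE dCE dSE; ring.
  by rewrite !fctE /E /c /s C0 S0 p0 q0 cos0 oppr0 expR0; ring.
have V : E t * (S t * c t - C t * s t) = 0.
  transitivity ((E * (S * c - C * s)) 0).
    apply: (@is_derive_0_is_cst _ (E * (S * c - C * s))) => x.
    have Cx := C1 x; have Sx := S1 x; have [dCE dSE] := dE x.
    by apply: is_derive_eq; rewrite /GRing.scale/= !fctE dCE dSE; ring.
  by rewrite !fctE /E /c /s C0 S0 p0 q0 cos0 sin0 oppr0 expR0; ring.
have EE : E t * expR (p t) = 1 by rewrite -expRD addNr expR0.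
have cs : c t ^+ 2 + s t ^+ 2 = 1 by exact: cos2Dsin2.
(* Multiplying back by [exp (p + i q)] recovers [C] and [S] from the two conserved quantities, using
   [EE] and [cs]. *)
have CE : C t = expR (p t) * (c t * (E t * (C t * c t + S t * s t)) -
    s t * (E t * (S t * c t - C t * s t))).
  rewrite -[LHS]mulr1 -cs -[LHS]mulr1 -EE; ring.
have SE : S t = expR (p t) * (s t * (E t * (C t * c t + S t * s t)) +
    c t * (E t * (S t * c t - C t * s t))).
  rewrite -[LHS]mulr1 -cs -[LHS]mulr1 -EE; ring.
by split; [rewrite CE|rewrite SE]; rewrite U V mulr0 ?subr0 ?addr0 mulr1.
Qed.

End exponential_equation.

(** * Bounded Lipschitz functions and the classes that determine [L] on them *)

Section bounded_lipschitz.
Context {R : realType}.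

Definition bounded_lipschitz (f : R -> R) :=
  (exists C, forall x y, `|f x - f y| <= C * `|x - y|) /\
  (exists M, forall x, `|f x| <= M).

(** [bounded_fun] and [lipschitz] give bounds for every constant strictly above some threshold.
    Adding 1 to its absolute value yields an explicit constant; conversely, any larger constant also
    works. *)
Lemma bounded_lipschitzP (f : R -> R) :
  (bounded_fun f /\ lipschitz f) <-> bounded_lipschitz f.
Proof.
split=> [[[M [_ fM]] [C [_ fC]]]|[[C fC] [M fM]]].
  split.
    exists (`|C| + 1) => x y.
    apply: (fC (`|C| + 1) _ (x, y)) => //.
    by rewrite (le_lt_trans (ler_norm C))// ltrDl.
  exists (`|M| + 1) => x; apply: fM => //.
  by rewrite (le_lt_trans (ler_norm M))// ltrDl.
split.
  exists M; split; first exact: num_real.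
  by move=> K MK x _ /=; rewrite (le_trans (fM x))// ltW.
exists C; split; first exact: num_real.
by move=> K CK [x y] _ /=; rewrite (le_trans (fC x y))// ler_wpM2r// ltW.
Qed.

Lemma bounded_lipschitz_measurable (f : R -> R) :
  bounded_lipschitz f -> bounded_measurable f.
Proof.
move=> [[C fC] fM]; split=> //; apply: continuous_measurable_fun => x.
apply/cvgrPdist_le => e e0.
have C0 : 0 <= C by have := fC 1 0; rewrite subr0 normr1 mulr1; exact: le_trans.
have d0 : 0 < e / (C + 1) by rewrite divr_gt0// ltr_wpDl.
near=> y; rewrite (le_trans (fC x y))//.
have : `|x - y| <= e / (C + 1).
  by near: y; exact: (@cvgr_dist_le _ _ _ _ _ id x).
rewrite ler_pdivlMr ?ltr_wpDl// => h; apply: le_trans h.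
by rewrite mulrC ler_wpM2l// lerDl.
Unshelve. all: end_near. Qed.

Lemma bounded_lipschitz_cosM (t : R) : bounded_lipschitz (fun x => cos (t * x)).
Proof.
split; last by exists 1 => x; exact: cos_max.
exists `|t| => x y.
rewrite (mulrC t x) (mulrC t y).
apply: (@mean_value_le _ (fun x => cos (x * t))
  (fun x => - (t * sin (x * t)))) => z.
  exact: is_derive_cosM.
by rewrite normrN normrM ler_piMr// sin_max.
Qed.

Lemma bounded_lipschitz_sinM (t : R) : bounded_lipschitz (fun x => sin (t * x)).
Proof.
split; last by exists 1 => x; exact: sin_max.
exists `|t| => x y.
rewrite (mulrC t x) (mulrC t y).
apply: (@mean_value_le _ (fun x => sin (x * t))
  (fun x => t * cos (x * t))) => z.
  exact: is_derive_sinM.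
by rewrite normrM ler_piMr// cos_max.
Qed.

Lemma sigma_linear_rays_eq0 (L : (R -> R) -> R) (f : R -> R) : sigma_linear L ->
  (forall b : R, L (\1_`]b, +oo[%classic : R -> R) = 0) ->
  bounded_lipschitz f -> L f = 0.
Proof.
by move=> sL L0 [[C fC] [M fM]]; exact: (sigma_linear_rays0 sL L0 fC fM).
Qed.

Lemma sigma_linear_cos_sin_eq0 (L : (R -> R) -> R) (f : R -> R) :
  sigma_linear L ->
  (forall t, L (fun x => cos (t * x)) = 0) ->
  (forall t, L (fun x => sin (t * x)) = 0) ->
  bounded_lipschitz f -> L f = 0.
Proof.
move=> sL Lc Ls; apply: sigma_linear_rays_eq0 => // b.
apply: sigma_linear_trig_ray => // t s.
have bc := bounded_lipschitz_measurable (bounded_lipschitz_cosM t).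
have bs := bounded_lipschitz_measurable (bounded_lipschitz_sinM t).
have [L0 _] := sL.
(* The addition formula for the cosine, with [cos s] split as [(cos s - 1) + 1] so that two uses of
   linearity suffice. *)
rewrite (_ : (fun x => _) = fun x => (cos s - 1) * cos (t * x) +
  (- sin s * sin (t * x) + cos (t * x))); last first.
  by apply/funext => x; rewrite cosD; ring.
by rewrite L0 ?L0// ?Lc ?Ls; [ring|exact: bounded_measurable_lin].
Qed.

End bounded_lipschitz.

(** * Independence and mixture laws tested on functions *)

Section laws.
Context {R : realType} d (T : measurableType d) (P : probability T R).

Lemma Rintegral_indic d' (S : measurableType d')
    (mu : {measure set S -> \bar R}) (A : set S) :
  measurable A -> \int[mu]_x (\1_A x) = fine (mu A).
Proof. by move=> mA; rewrite /Rintegral integral_indic// setIT. Qed.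

Lemma integrable_comp_bounded_lipschitz (Z : T -> R) f :
  measurable_fun setT Z -> bounded_lipschitz f ->
  P.-integrable setT (EFin \o (fun w => f (Z w))).
Proof.
move=> mZ bf; have [mf [M fM]] := bounded_lipschitz_measurable bf.
rewrite (_ : (fun w => f (Z w)) = fun w => cst 1 w * f (Z w)); last first.
  by apply/funext => w; rewrite mul1r.
apply: (@integrable_mul_bounded R _ _ _ _ _ (f \o Z) M) => //.
- exact: finite_measure_integrable_cst.
- exact: (measurableT_comp mf mZ).
- by move=> x; exact: fM.
Qed.

(** For two rays this is the hypothesis. [step1] extends it from rays to [f] with the ray of [Y]
    fixed; a second extension, with [f] fixed, reaches [g]. *)
Lemma Rintegral_independent (X Y : {RV P >-> R}) (f g : R -> R) :
  (forall A B : set R, measurable A -> measurable B ->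
    P (X @^-1` A `&` Y @^-1` B) = (P (X @^-1` A) * P (Y @^-1` B))%E) ->
  bounded_lipschitz f -> bounded_lipschitz g ->
  \int[P]_w (f (X w) * g (Y w)) = \int[P]_w f (X w) * \int[P]_w g (Y w).
Proof.
move=> XY bf bg.
have i1 : P.-integrable setT (EFin \o cst (1 : R)).
  exact: finite_measure_integrable_cst.
have mpre (Z : {RV P >-> R}) (b : R) : measurable (Z @^-1` `]b, +oo[%classic).
  exact: measurable_funPTI.
have indic_pre (Z : {RV P >-> R}) (b : R) (w : T) :
  \1_`]b, +oo[%classic (Z w) = \1_(Z @^-1` `]b, +oo[%classic) w :> R by [].
have step1 (b : R) : \int[P]_w (f (X w) * \1_`]b, +oo[%classic (Y w)) =
    \int[P]_w f (X w) * \int[P]_w \1_`]b, +oo[%classic (Y w).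
  pose B := Y @^-1` `]b, +oo[%classic.
  have mB : measurable B by exact: mpre.
  pose L (h : R -> R) := - fine (P B) * (\int[P]_w (cst 1 w * h (X w))) +
    \int[P]_w (\1_B w * h (X w)).
  have sL : sigma_linear L.
    apply: sigma_linear_lin; apply: sigma_linear_integral => //.
    exact: integrable_indic.
  have : L f = 0.
    apply: sigma_linear_rays_eq0 => // a; rewrite /L.
    have -> : \int[P]_w (cst 1 w * \1_`]a, +oo[%classic (X w)) =
        fine (P (X @^-1` `]a, +oo[%classic)).
      rewrite -Rintegral_indic//; apply: eq_Rintegral => w _.
      by rewrite mul1r indic_pre.
    have -> : \int[P]_w (\1_B w * \1_`]a, +oo[%classic (X w)) =
        fine (P (X @^-1` `]a, +oo[%classic `&` B)).
      rewrite -Rintegral_indic; last exact: measurableI.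
      by apply: eq_Rintegral => w _; rewrite indicI/= mulrC indic_pre.
    by rewrite XY// fineM ?fin_num_measure//; ring.
  have -> : \int[P]_w \1_`]b, +oo[%classic (Y w) = fine (P B).
    by rewrite -Rintegral_indic.
  have -> : \int[P]_w (f (X w) * \1_`]b, +oo[%classic (Y w)) =
      \int[P]_w (\1_B w * f (X w)).
    by apply: eq_Rintegral => w _; rewrite mulrC.
  rewrite /L; under eq_Rintegral do rewrite mul1r.
  by move=> ?; lra.
pose L (h : R -> R) := - (\int[P]_w f (X w)) * (\int[P]_w (cst 1 w * h (Y w))) +
    \int[P]_w (f (X w) * h (Y w)).
have sL : sigma_linear L.
  apply: sigma_linear_lin; apply: sigma_linear_integral => //.
  exact: integrable_comp_bounded_lipschitz.
have LE h : L h = - (\int[P]_w f (X w)) * (\int[P]_w h (Y w)) +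
    \int[P]_w (f (X w) * h (Y w)).
  by congr (_ * _ + _); apply: eq_Rintegral => w _; rewrite mul1r.
suff : L g = 0 by rewrite LE => ?; lra.
by apply: sigma_linear_rays_eq0 => // b; rewrite LE step1 mulNr addNr.
Qed.

(** The difference of the two sides is sigma-linear in [g], and on rays it vanishes by the law of
    [Y], since [mu] has density [w] with respect to [nu]. *)
Lemma Rintegral_mixture_law
    (nu mu : {measure set (measurableTypeR R) -> \bar R}) (w : R -> R)
    (Y : {RV P >-> R}) (c m : R) (g : R -> R) :
  nu.-integrable setT (EFin \o w) ->
  (forall A, measurable A -> mu A = \int[nu]_(u in A) (w u)%:E)%E ->
  m != 0 -> has_mixture_law Y c m mu -> bounded_lipschitz g ->
  m * \int[P]_w g (Y w) = c * g 0 + \int[nu]_u (w u * g u).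
Proof.
move=> iw muE m0 law bg.
have i1 : P.-integrable setT (EFin \o cst (1 : R)).
  exact: finite_measure_integrable_cst.
(* The factors [cst 1] and [-1] and the final [0] fit the shapes of [sigma_linear_integral] and
   [sigma_linear_lin]. *)
pose L (h : R -> R) := m * (\int[P]_w (cst 1 w * h (Y w))) +
  (- c * h 0 + (-1 * \int[nu]_u (w u * h u) + 0)).
have sL : sigma_linear L.
  apply: sigma_linear_lin; first exact: sigma_linear_integral.
  apply: sigma_linear_lin; first exact: sigma_linear_eval.
  apply: sigma_linear_lin; last exact: sigma_linear0.
  apply: (@sigma_linear_integral R _ (measurableTypeR R) nu w idfun iw).
  exact: measurable_id.
have LE h : L h = m * (\int[P]_w h (Y w)) +
    (- c * h 0 + (-1 * \int[nu]_u (w u * h u) + 0)).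
  by congr (_ * _ + _); apply: eq_Rintegral => x _; rewrite mul1r.
suff : L g = 0 by rewrite LE => ?; lra.
  apply: sigma_linear_rays_eq0 => // b; rewrite LE.
  set A : set R := `]b, +oo[%classic.
  have mA : measurable A by exact: measurable_itv.
  have -> : \int[P]_w \1_A (Y w) = fine (P (Y @^-1` A)).
    by rewrite -Rintegral_indic//; exact: measurable_funPTI.
  have -> : P (Y @^-1` A) = distribution P Y A by [].
  have -> : \int[nu]_u (w u * \1_A u) = fine (mu A).
    rewrite muE// -[RHS]/(Rintegral nu A w) [RHS]Rintegral_mkcond.
    apply: eq_Rintegral => u _; rewrite patchE indicE.
    by case: ifP; rewrite ?mulr1 ?mulr0.
  (* Finiteness lets [fine] distribute over the sum and products in the law. *)
  have fmu : mu A \is a fin_num.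
    by rewrite muE// integrable_fin_num//; exact: (integrableS measurableT).
  rewrite law// diracE fineD ?fin_numM// !fineM//=.
  by rewrite indicE; field.
Qed.

End laws.

(** * The Lévy exponent in real form *)

Section levy_exponent.
Context {R : realType}.

(** Boundedness of the sine is not enough, as [nu] may be infinite; the bound used is
    [|sin (t u)| <= |t u|]. *)
Lemma integrable_sinM (nu : {measure set (measurableTypeR R) -> \bar R})
    (t : R) :
  nu.-integrable setT (EFin \o (fun u : R => u)) ->
  nu.-integrable setT (EFin \o (fun u : R => sin (t * u))).
Proof.
move=> iu.
have [ms _] := bounded_lipschitz_measurable (bounded_lipschitz_sinM t).
apply: (le_integrable measurableT _ _ (integrableZl measurableT t iu)).
  exact/measurable_EFinP.
move=> u _ /=; rewrite lee_fin normrM.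
have := @mean_value_le R (fun x => sin (x * t)) (fun x => t * cos (x * t)) `|t|.
move=> /(_ (is_derive_sinM t)) /(_ _ u 0).
rewrite mul0r sin0 !subr0 (mulrC u); apply.
by move=> x; rewrite normrM ler_piMr// cos_max.
Qed.

(** Since [u] is [nu]-integrable, the truncation term can be integrated separately and absorbed into
    the drift. *)
Lemma Rintegral_drift (b : R) (nu : {measure set (measurableTypeR R) -> \bar R})
    (t : R) : nu.-integrable setT (EFin \o (fun u : R => u)) ->
  t * b + \int[nu]_u (sin (t * u) - t * u * \1_[set v : R | `|v| <= 1] u) =
  t * b0 b nu + \int[nu]_u sin (t * u).
Proof.
move=> iu; set D := [set v : R | _].
have mD : measurable (D : set (measurableTypeR R)).
  rewrite (_ : D = `[-1, 1]%classic); first exact: measurable_itv.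
  by apply/seteqP; split => x; rewrite /D/= in_itv/= ler_norml.
have iD : nu.-integrable setT (EFin \o (fun u : R => u * \1_D u)).
  apply: (@integrable_mul_bounded R _ (measurableTypeR R) nu id iu \1_D 1).
    exact: measurable_indic.
  by move=> u; rewrite indicE; case: (_ \in _); rewrite ?normr1 ?normr0.
have -> : \int[nu]_u (sin (t * u) - t * u * \1_D u) =
    \int[nu]_u (sin (t * u) - t * (u * \1_D u)).
  by apply: eq_Rintegral => u _; rewrite mulrA.
rewrite RintegralB//; [|exact: integrable_sinM|
  exact: (integrableZl measurableT t iD)].
rewrite RintegralZl// /b0 -/D [X in b - X]Rintegral_mkcond.
have -> : \int[nu]_u (u * \1_D u) = \int[nu]_u ((fun x => x) \_ D) u.
  apply: eq_Rintegral => u _; rewrite patchE indicE.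
  by case: ifP; rewrite ?mulr1 ?mulr0.
ring.
Qed.

Local Open Scope complex_scope.

Lemma expC_iM (r : R) : expC ('i * r%:C) = cos r +i* sin r.
Proof. by rewrite /expC /=; simpc; rewrite expR0; simpc. Qed.

(** Comparing real and imaginary parts removes complex numbers from the rest of the argument. *)
Lemma ID_cos_sin d (T : measurableType d) (P : probability T R)
    (X : {RV P >-> R}) (b : R)
    (nu : {measure set (measurableTypeR R) -> \bar R}) :
  nu.-integrable setT (EFin \o (fun u : R => u)) ->
  ID X b nu <-> forall t,
    let p := \int[nu]_u (cos (t * u) - 1) in
    let q := t * b0 b nu + \int[nu]_u sin (t * u) in
    \int[P]_w cos (t * X w) = expR p * cos q /\
    \int[P]_w sin (t * X w) = expR p * sin q.
Proof.
move=> iu.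
have charE t : char_fun X t =
    (\int[P]_w cos (t * X w)) +i* (\int[P]_w sin (t * X w)).
  by rewrite /char_fun /Cintegral; congr (_ +i* _); apply: eq_Rintegral => w _;
    rewrite expC_iM.
have levyE t : levy_exponent b nu t = (\int[nu]_u (cos (t * u) - 1)) +i*
    (t * b0 b nu + \int[nu]_u sin (t * u)).
  rewrite /levy_exponent -Rintegral_drift// /Cintegral; simpc.
  by congr (_ +i* _); [|congr (_ + _)]; apply: eq_Rintegral => u _;
    rewrite expC_iM/=; simpc.
have expE (x y : R) : expC (x +i* y) = (expR x * cos y) +i* (expR x * sin y).
  by rewrite /expC; simpc.
split=> h t.
  by have := h t; rewrite charE levyE expE => -[-> ->].
by rewrite charE levyE expE; have [-> ->] := h t.
Qed.

End levy_exponent.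

(** * Transforms of a sum of independent variables *)

Section addition_formulas.
Context {R : realType} d (T : measurableType d) (P : probability T R).
Context (X Y : {RV P >-> R}).
Context (XY : forall A B : set R, measurable A -> measurable B ->
  P (X @^-1` A `&` Y @^-1` B) = (P (X @^-1` A) * P (Y @^-1` B))%E).

Let integrable_mul_comp (f g : R -> R) :
  bounded_lipschitz f -> bounded_lipschitz g ->
  P.-integrable setT (EFin \o (fun w => f (X w) * g (Y w))).
Proof.
move=> bf bg; have [mg [M gM]] := bounded_lipschitz_measurable bg.
apply: (@integrable_mul_bounded R _ T P (f \o X) _ (g \o Y) M) => //.
- exact: integrable_comp_bounded_lipschitz.
- exact: (measurableT_comp mg).
- by move=> w; exact: gM.
Qed.

Lemma Rintegral_cosD (t : R) : \int[P]_w cos (t * (X w + Y w)) =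
  \int[P]_w cos (t * X w) * \int[P]_w cos (t * Y w) -
  \int[P]_w sin (t * X w) * \int[P]_w sin (t * Y w).
Proof.
have bc := bounded_lipschitz_cosM t; have bs := bounded_lipschitz_sinM t.
rewrite -(Rintegral_independent XY bc bc) -(Rintegral_independent XY bs bs).
rewrite -RintegralB//; [|exact: (integrable_mul_comp bc bc)|
  exact: (integrable_mul_comp bs bs)].
by apply: eq_Rintegral => w _; rewrite mulrDr cosD.
Qed.

Lemma Rintegral_sinD (t : R) : \int[P]_w sin (t * (X w + Y w)) =
  \int[P]_w sin (t * X w) * \int[P]_w cos (t * Y w) +
  \int[P]_w cos (t * X w) * \int[P]_w sin (t * Y w).
Proof.
have bc := bounded_lipschitz_cosM t; have bs := bounded_lipschitz_sinM t.
rewrite -(Rintegral_independent XY bs bc) -(Rintegral_independent XY bc bs).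
rewrite -RintegralD//; [|exact: (integrable_mul_comp bs bc)|
  exact: (integrable_mul_comp bc bs)].
by apply: eq_Rintegral => w _; rewrite mulrDr sinD.
Qed.

End addition_formulas.

(** * Derivatives of cosine and sine transforms *)

Section transform_derivatives.
Context {R : realType} d (T : measurableType d).
Context (mu : {measure set T -> \bar R}).
Context (X : T -> R) (iX : mu.-integrable setT (EFin \o X)).

(** Subtracting 1 makes the integrand vanish at [t = 0], as [is_derive_integral] demands, and keeps
    it integrable for an infinite [mu]. *)
Lemma is_derive_Rintegral_cos (t : R) :
  is_derive t 1 (fun t => \int[mu]_x (cos (t * X x) - 1))
    (- \int[mu]_x (X x * sin (t * X x))).
Proof.
have mX : measurable_fun setT X by case/integrableP: iX => /measurable_EFinP.
have Xs (s : R) : mu.-integrable setT (EFin \o (fun x => X x * sin (s * X x))).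
  have [ms _] := bounded_lipschitz_measurable (bounded_lipschitz_sinM s).
  apply: (@integrable_mul_bounded R _ T mu X iX (fun x => sin (s * X x)) 1).
    exact: (measurableT_comp ms mX).
  by move=> x; exact: sin_max.
have -> : - (\int[mu]_x (X x * sin (t * X x))) =
    \int[mu]_x (- 1 * (X x * sin (t * X x))).
  by rewrite RintegralZl// mulN1r.
apply: (@is_derive_integral R _ T mu X (fun t x => cos (t * X x) - 1)
  (fun t x => - 1 * (X x * sin (t * X x)))) => //.
- move=> s; apply: measurable_funB => //.
  have [mc _] := bounded_lipschitz_measurable (bounded_lipschitz_cosM s).
  exact: (measurableT_comp mc mX).
- by move=> x; rewrite mul0r cos0 subrr.
- move=> s x; have H := is_derive_cosM (X x) s.
  by apply: is_derive_eq; rewrite subr0 mulN1r.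
- move=> s x; rewrite mulN1r normrN normrM ler_piMr//; exact: sin_max.
Qed.

Lemma is_derive_Rintegral_sin (t : R) :
  is_derive t 1 (fun t => \int[mu]_x sin (t * X x))
    (\int[mu]_x (X x * cos (t * X x))).
Proof.
have mX : measurable_fun setT X by case/integrableP: iX => /measurable_EFinP.
apply: (@is_derive_integral R _ T mu X (fun t x => sin (t * X x))
  (fun t x => X x * cos (t * X x))) => //.
- move=> s.
  have [ms _] := bounded_lipschitz_measurable (bounded_lipschitz_sinM s).
  exact: (measurableT_comp ms mX).
- by move=> x; rewrite mul0r sin0.
- by move=> s x; exact: is_derive_sinM.
- move=> s x; rewrite normrM ler_piMr//; exact: cos_max.
Qed.

End transform_derivatives.

(** The masses cancel the normalisations of the laws, and [u] and [b0] are recovered from their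
    positive and negative parts. For [g = cos (t .)] and [g = sin (t .)] the right side is [q'] and
    [- p'], where [p + i q] is the Lévy exponent. *)
Lemma Rintegral_mixture_diff (R : realType) d (T : measurableType d)
    (P : probability T R) (nu : {measure set (measurableTypeR R) -> \bar R})
    (b : R) (Yp Ym : {RV P >-> R}) (g : R -> R) :
  nu.-integrable setT (EFin \o (fun u : R => u)) ->
  m0p b nu != 0 -> m0m b nu != 0 ->
  has_mixture_law Yp (b0p b nu) (m0p b nu) (tnup nu) ->
  has_mixture_law Ym (b0m b nu) (m0m b nu) (tnum nu) ->
  bounded_lipschitz g ->
  m0p b nu * \int[P]_w g (Yp w) - m0m b nu * \int[P]_w g (Ym w) =
  b0 b nu * g 0 + \int[nu]_u (u * g u).
Proof.
move=> iu mp0 mm0 lp lm bg.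
have iw (A : set (measurableTypeR R)) : measurable A ->
    nu.-integrable setT (EFin \o (fun u : R => u * \1_A u)).
  move=> mA.
  apply: (@integrable_mul_bounded R _ (measurableTypeR R) nu id iu \1_A 1).
    exact: measurable_indic.
  by move=> u; rewrite indicE; case: (_ \in _); rewrite ?normr1 ?normr0.
have iwp := iw `]0, +oo[%classic (measurable_itv _).
have iwm : nu.-integrable setT
    (EFin \o (fun u : R => - u * \1_(`]-oo, 0[%classic) u)).
  have := integrableZl measurableT (-1)
    (iw `]-oo, 0[%classic (measurable_itv _)).
  by apply: eq_integrable => // u _ /=; rewrite -EFinM mulN1r mulNr.
rewrite (Rintegral_mixture_law iwp _ mp0 lp bg)//.
rewrite (Rintegral_mixture_law iwm _ mm0 lm bg)//.
have [mg [M gM]] := bounded_lipschitz_measurable bg.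
have ig (w : R -> R) : nu.-integrable setT (EFin \o w) ->
    nu.-integrable setT (EFin \o (fun u => w u * g u)).
  move=> /(@integrable_mul_bounded R _ (measurableTypeR R) nu w); apply.
    exact: mg.
  exact: gM.
have -> : \int[nu]_u (u * g u) = \int[nu]_u (u * \1_`]0%R, +oo[ u * g u) -
    \int[nu]_u (- u * \1_`]-oo, 0%R[ u * g u).
  rewrite -RintegralB//; [|exact: ig|exact: ig].
  apply: eq_Rintegral => u _; rewrite !indicE !mem_setE/= !in_itv/= andbT.
  by case: ltgtP => [||<-] *; rewrite ?mulr1n ?mulr0n; ring.
have -> : b0 b nu = b0p b nu - b0m b nu.
  rewrite /b0p /b0m; set c := b0 b nu.
  case: (leP c 0) => c0; last by rewrite max_r ?oppr_le0 ?ltW// subr0.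
  by rewrite max_l ?oppr_ge0// sub0r opprK.
ring.
Qed.

(** * The identity on test functions and the exponential equation *)

Unset Implicit Arguments.

Theorem corollary3p1 (R : realType) (d : measure_display)
    (T : measurableType d) (P : probability T R) (X : {RV P >-> R})
    (nu : {measure set (measurableTypeR R) -> \bar R}) (b : R)
    (Yp Ym : {RV P >-> R}) :
  nondegenerate_RV X ->
  ('E_P[fun w => `|X w|%R] < +oo)%E ->
  levy_measure nu ->
  (\int[nu]_u `|u|%:E < +oo)%E ->
  m0p b nu != 0 ->
  m0m b nu != 0 ->
  independent3 X Yp Ym ->
  has_mixture_law Yp (b0p b nu) (m0p b nu) (tnup nu) ->
  has_mixture_law Ym (b0m b nu) (m0m b nu) (tnum nu) ->
  ((forall f : R -> R, bounded_fun f -> lipschitz f ->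
      ('E_P[fun w => (X w * f (X w))%R] =
       (m0p b nu)%:E * 'E_P[fun w => f (X w + Yp w)%R] -
       (m0m b nu)%:E * 'E_P[fun w => f (X w + Ym w)%R])%E)
   <-> ID X b nu).
Proof.
move=> _ EX _ nuu mp0 mm0 ind lp lm.
have iu : nu.-integrable setT (EFin \o (fun u : R => u)).
  by apply/integrableP; split=> //; exact/measurable_EFinP.
have iX : P.-integrable setT (EFin \o X).
  apply/integrableP; split; first exact/measurable_EFinP.
  by move: EX; rewrite unlock.
have XYp (A B : set R) : measurable A -> measurable B ->
    P (X @^-1` A `&` Yp @^-1` B) = (P (X @^-1` A) * P (Yp @^-1` B))%E.
  move=> mA mB; have := ind A B setT mA mB measurableT.
  by rewrite !preimage_setT setIT probability_setT mule1.
have XYm (A B : set R) : measurable A -> measurable B ->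
    P (X @^-1` A `&` Ym @^-1` B) = (P (X @^-1` A) * P (Ym @^-1` B))%E.
  move=> mA mB; have := ind A setT B mA measurableT mB.
  by rewrite !preimage_setT setIT probability_setT mule1.
pose L (f : R -> R) := - m0p b nu * (\int[P]_w (cst 1 w * f (X w + Yp w))) +
  (m0m b nu * (\int[P]_w (cst 1 w * f (X w + Ym w))) +
   \int[P]_w (X w * f (X w))).
have sL : sigma_linear L.
  have i1 : P.-integrable setT (EFin \o cst (1 : R)).
    exact: finite_measure_integrable_cst.
  apply: sigma_linear_lin.
    by apply: sigma_linear_integral => //; exact: measurable_funD.
  apply: sigma_linear_lin.
    by apply: sigma_linear_integral => //; exact: measurable_funD.
  exact: sigma_linear_integral.
have LE f : L f = \int[P]_w (X w * f (X w)) -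
    (m0p b nu * (\int[P]_w f (X w + Yp w)) -
     m0m b nu * (\int[P]_w f (X w + Ym w))).
  have cst1E (Y : T -> R) : \int[P]_w (cst 1 w * f (X w + Y w)) =
      \int[P]_w f (X w + Y w).
    by apply: eq_Rintegral => w _; rewrite mul1r.
  by rewrite /L !cst1E; ring.
have EE (h : T -> R) : P.-integrable setT (EFin \o h) ->
    ('E_P[h] = (\int[P]_w h w)%R%:E)%E.
  by move=> ih; rewrite unlock fineK// integrable_fin_num.
(* All three expectations are finite for bounded [f], so the identity in the extended reals amounts
   to one between real integrals. *)
have steinE f : bounded_lipschitz f -> ('E_P[fun w => (X w * f (X w))%R] =
       (m0p b nu)%:E * 'E_P[fun w => f (X w + Yp w)%R] -
       (m0m b nu)%:E * 'E_P[fun w => f (X w + Ym w)%R])%E <-> L f = 0.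
  move=> bf; have [mf [M fM]] := bounded_lipschitz_measurable bf.
  have iXf : P.-integrable setT (EFin \o (fun w => X w * f (X w))).
    apply: (@integrable_mul_bounded R _ T P X iX (f \o X) M).
      exact: (measurableT_comp mf).
    by move=> w; exact: fM.
  have iY (Y : {RV P >-> R}) :
      P.-integrable setT (EFin \o (fun w => f (X w + Y w))).
    apply: (@integrable_comp_bounded_lipschitz R _ T P
      (fun w => X w + Y w)) => //.
    exact: measurable_funD.
  rewrite !EE// -!EFinM -EFinB LE.
  split=> [[->]|/eqP]; first by rewrite subrr.
  by rewrite subr_eq0 => /eqP ->.
have int1 : \int[P]_w 1 = 1.
  have P1 : fine (P setT) = 1 by rewrite probability_setT.
  by rewrite Rintegral_cst// mul1r; exact: P1.
pose C t := \int[P]_w cos (t * X w).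
pose S t := \int[P]_w sin (t * X w).
pose p t := \int[nu]_u (cos (t * u) - 1).
pose q t := t * b0 b nu + \int[nu]_u sin (t * u).
pose dp t := - \int[nu]_u (u * sin (t * u)).
pose dq t := b0 b nu + \int[nu]_u (u * cos (t * u)).
pose dC t := - \int[P]_w (X w * sin (t * X w)).
pose dS t := \int[P]_w (X w * cos (t * X w)).
have Cder (t : R) : is_derive t (1 : R) C (dC t).
  (* [P] has mass 1, so restoring the subtracted constant adds exactly 1. *)
  have -> : C = (fun t => \int[P]_w (cos (t * X w) - 1)) + cst 1.
    apply/funext => s; rewrite !fctE RintegralB//.
    - by rewrite int1 subrK.
    - exact: integrable_comp_bounded_lipschitz (bounded_lipschitz_cosM s).
    - exact: finite_measure_integrable_cst.
  have H := is_derive_Rintegral_cos iX t.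
  by apply: is_derive_eq; rewrite addr0.
have Sder (t : R) : is_derive t (1 : R) S (dS t).
  exact: is_derive_Rintegral_sin.
have pder (t : R) : is_derive t (1 : R) p (dp t).
  exact: (is_derive_Rintegral_cos iu).
have qder (t : R) : is_derive t (1 : R) q (dq t).
  have H := is_derive_Rintegral_sin iu t.
  by apply: is_derive_eq; rewrite /GRing.scale/= /dq; ring.
(* By the addition formulas, [C t] gets as coefficient the weighted difference of the cosine
   transforms of [Yp] and [Ym], which is [dq t]; the one for the sines is [- dp t]. *)
have Lcos t : L (fun x => cos (t * x)) = dS t - (dp t * S t + dq t * C t).
  rewrite LE !Rintegral_cosD//.
  have := Rintegral_mixture_diff iu mp0 mm0 lp lm (bounded_lipschitz_cosM t).
  have := Rintegral_mixture_diff iu mp0 mm0 lp lm (bounded_lipschitz_sinM t).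
  rewrite mulr0 cos0 sin0 mulr0 add0r mulr1 -/(dq t) => sE cE.
  rewrite -/(dS t) -/(C t) -/(S t) -cE /dp -sE; ring.
have Lsin t : L (fun x => sin (t * x)) = - dC t + (dp t * C t - dq t * S t).
  rewrite LE !Rintegral_sinD//.
  have := Rintegral_mixture_diff iu mp0 mm0 lp lm (bounded_lipschitz_cosM t).
  have := Rintegral_mixture_diff iu mp0 mm0 lp lm (bounded_lipschitz_sinM t).
  rewrite mulr0 cos0 sin0 mulr0 add0r mulr1 -/(dq t) => sE cE.
  rewrite /dC opprK -/(C t) -/(S t) -cE /dp -sE; ring.
rewrite (ID_cos_sin X b iu).
split=> [stein|CSE].
  (* The first four goals are the values at 0; the equation itself comes from testing the identity
     on [cos (t .)] and [sin (t .)]. *)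
  apply: (exp_eq_unique Cder Sder pder qder).
  - rewrite /C; under eq_Rintegral do rewrite mul0r cos0.
    exact: int1.
  - rewrite /S; under eq_Rintegral do rewrite mul0r sin0.
    by rewrite Rintegral_cst// mul0r.
  - rewrite /p; under eq_Rintegral do rewrite mul0r cos0 subrr.
    by rewrite Rintegral_cst// mul0r.
  - rewrite /q; under eq_Rintegral do rewrite mul0r sin0.
    by rewrite Rintegral_cst// !mul0r addr0.
  move=> t.
  have L0 f : bounded_lipschitz f -> L f = 0.
    move=> bf; have [? ?] := (bounded_lipschitzP f).2 bf.
    by apply/(steinE f bf); exact: stein.
  have := L0 _ (bounded_lipschitz_cosM t).
  have := L0 _ (bounded_lipschitz_sinM t).
  by rewrite Lcos Lsin => ? ?; split; lra.
(* Conversely, differentiating the exponential form makes [L] vanish on all cosines and sines, hence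
   on every bounded Lipschitz function. *)
have dE := exp_eq_derive Cder Sder pder qder
  (fun t => (CSE t).1) (fun t => (CSE t).2).
move=> f bf lf; have bl := (bounded_lipschitzP f).1 (conj bf lf).
apply/(steinE f bl); apply: sigma_linear_cos_sin_eq0 => // t.
  by rewrite Lcos (dE t).2 subrr.
by rewrite Lsin (dE t).1 addNr.
Qed.
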